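(* Let $d,r,k\geq1$ and $0\leq s\leq d$ be integers and let $C>0$. Let $\mathcal{A}$ be (a realization of) the subsampled Walsh--Hadamard measurement operator. Let $\mathcal{X}^\star\in\mathfrak{M}_{r,s,k}(C)$ and $\mathbf{y}=\mathcal{A}(\mathcal{X}^\star)$. Suppose that there is a constant $\varepsilon<1$ such that $$(1-\varepsilon)\|\mathcal{D}\|_F^2\leq\|\mathcal{A}(\mathcal{D})\|_2^2\leq(1+\varepsilon)\|\mathcal{D}\|_F^2\qquad\text{for every }\mathcal{D}\in\mathfrak{M}_{2r,s,2k}(2C).$$ Then $\mathcal{X}^\star$ is the unique minimizer of $$\min_{\mathcal{X}\in\mathfrak{M}_{r,s,k}(C)}\ \|\mathcal{A}(\mathcal{X})-\mathbf{y}\|_2 .$$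
   Context: Let $N=2^d$. Tensors $\mathcal{X}\in\mathbb{R}^{2\times\cdots\times 2}$ have $d$ modes, each of size 2. Vectorization: $[\operatorname{vec}(\mathcal{X})]_j=\mathcal{X}(i_1,\ldots,i_d)$ with $j=1+\sum_{q=1}^d(i_q-1)2^{q-1}$, $i_q\in\{1,2\}$. The Frobenius norm is $\|\mathcal{X}\|_F=\|\operatorname{vec}(\mathcal{X})\|_2$. Measurement operator. Let $\mathbf{H}_2=\frac{1}{\sqrt2}\begin{bmatrix}1&1\\1&-1\end{bmatrix}$ and $\mathbf{H}=\mathbf{H}_2^{\otimes d}\in\mathbb{R}^{N\times N}$ (Kronecker power). Given indices $\nu_1,\ldots,\nu_m\in\{1,\ldots,N\}$ (drawn independently and uniformly with replacement), let $\mathbf{S}\in\mathbb{R}^{m\times N}$ be the matrix with $[\mathbf{S}\mathbf{z}]_\ell=z_{\nu_\ell}$. Set $\mathbf{A}=\sqrt{N/m}\,\mathbf{S}\mathbf{H}$ and $\mathcal{A}(\mathcal{X})=\mathbf{A}\operatorname{vec}(\mathcal{X})\in\mathbb{R}^m$. TT rank. For $q=1,\ldots,d-1$, let $\mathbf{X}^{\langle q\rangle}$ be the $2^q\times 2^{d-q}$ matrix unfolding of $\mathcal{X}$ whose row index is $(i_1,\ldots,i_q)$ and column index is $(i_{q+1},\ldots,i_d)$. Then $\operatorname{rank}_{\mathrm{TT}}(\mathcal{X})=(\operatorname{rank}\mathbf{X}^{\langle 1\rangle},\ldots,\operatorname{rank}\mathbf{X}^{\langle d-1\rangle})$, and $\operatorname{rank}_{\mathrm{TT}}(\mathcal{X})\leq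 r$ for a scalar $r$ means every component is at most $r$. Low-order model. Write $[d]=\{1,\ldots,d\}$. For $S\subseteq[d]$, let $\mathcal{E}_S$ be the canonical basis tensor whose single nonzero entry, equal to 1, is at the index with $i_j=2$ for $j\in S$ and $i_j=1$ for $j\notin S$. For integers $k\geq1$ define $$\mathrm{LC}_k(s)=\left\{\sum_{t=1}^k\mathcal{X}_{S_t}\ :\ S_t\subseteq[d],\ |S_t|\leq s,\ \mathcal{X}_{S_t}\in\operatorname{span}\{\mathcal{E}_I:I\subseteq S_t\},\ t=1,\ldots,k\right\}.$$ Model class (for any $r,s,k,C$): $$\mathfrak{M}_{r,s,k}(C)=\left\{\mathcal{X}\in\mathbb{R}^{2\times\cdots\times2}:\ \operatorname{rank}_{\mathrm{TT}}(\mathcal{X})\leq r,\ \mathcal{X}\in\mathrm{LC}_k(s),\ \|\mathcal{X}\|_F\leq C\right\}.$$ *)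

(* Defs.v *)
From mathcomp Require Import all_boot all_order all_algebra.
From mathcomp Require Import reals.
From mathcomp.real_closed Require Import mxtens.

Set Implicit Arguments.
Unset Strict Implicit.
Unset Printing Implicit Defensive.

Import Order.TTheory GRing.Theory Num.Theory.

Local Open Scope ring_scope.

(* Indices are 0-based: the values 1, 2 of a mode index i_q become 0, 1 : 'I_2,
   the modes 1, .., d become 0, .., d-1 : 'I_d, and the positions 1, .., 2^d of
   a vectorized tensor become 0, .., 2^d-1 : 'I_(2 ^ d). *)
Notation multi_index d := {ffun 'I_d -> 'I_2}.

(* R^o (rather than R) makes tensors a finite-dimensional vector space over R. *)
Notation tensor R d := {ffun multi_index d -> R^o}.

Definition bit (j q : nat) : 'I_2 := inord ((j %/ 2 ^ q) %% 2).

(* The multi-index i such that j = \sum_q i_q 2^q; see vecE. *)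
Definition multi_index_of (d j : nat) : multi_index d :=
  [ffun q : 'I_d => bit j q].

Definition vec (R : realType) (d : nat) (X : tensor R d) : 'cV[R]_(2 ^ d) :=
  \col_j X (multi_index_of d j).

Lemma bit_sum (d : nat) (i : multi_index d) (p : 'I_d) :
  bit (\sum_(q < d) i q * 2 ^ q) p = i p.
Proof.
apply: val_inj; rewrite /bit /= inordK ?ltn_mod //.
elim: d i p => [|d IHd] i p; first by case: p.
rewrite big_ord_recl /= expn0 muln1.
have -> : (\sum_(q < d) i (lift ord0 q) * 2 ^ bump 0 q =
    (\sum_(q < d) [ffun q => i (lift ord0 q)] q * 2 ^ q) * 2)%N.
  by rewrite big_distrl /=; apply: eq_bigr => q _; rewrite ffunE expnSr mulnA.
have [q -> | ->] := unliftP ord0 p; last first.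
  by rewrite /= expn0 divn1 addnC modnMDl modn_small ?ltn_ord.
rewrite /= expnS divnMA addnC divnMDl // (divn_small (ltn_ord _)) addn0.
exact: etrans (IHd [ffun q => i (lift ord0 q)] q) (congr1 val (ffunE _ _)).
Qed.

Lemma vecE (R : realType) (d : nat) (X : tensor R d) (i : multi_index d)
    (j : 'I_(2 ^ d)) :
  (j = \sum_(q < d) i q * 2 ^ q :> nat)%N -> vec X j 0 = X i.
Proof.
move=> jE; rewrite mxE; congr (X _).
by apply/ffunP => q; rewrite ffunE jE bit_sum.
Qed.

Definition l2norm (R : realType) (n : nat) (x : 'cV[R]_n) : R :=
  Num.sqrt (\sum_i x i 0 ^+ 2).

Definition frobenius (R : realType) (d : nat) (X : tensor R d) : R :=
  l2norm (vec X).

Definition hadamard2 (R : realType) : 'M[R]_2 :=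
  (Num.sqrt 2)^-1 *: \matrix_(i, j) (-1) ^+ (i * j).

Definition walsh_hadamard (R : realType) (d : nat) : 'M[R]_(2 ^ d) :=
  hadamard2 R ^t d.

Definition sampling_mx (R : realType) (m N : nat) (nu : 'I_m -> 'I_N) :
    'M[R]_(m, N) :=
  \matrix_(l, j) (j == nu l)%:R.

Definition measurement_mx (R : realType) (d m : nat)
    (nu : 'I_m -> 'I_(2 ^ d)) : 'M[R]_(m, 2 ^ d) :=
  Num.sqrt ((2 ^ d)%:R / m%:R) *: (sampling_mx R nu *m walsh_hadamard R d).

Definition measurement (R : realType) (d m : nat) (nu : 'I_m -> 'I_(2 ^ d))
    (X : tensor R d) : 'cV[R]_m :=
  measurement_mx R nu *m vec X.

(* Row a encodes the first q mode indices, column b the remaining d - q ones. *)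
Definition unfolding (R : realType) (d : nat) (X : tensor R d) (q : nat) :
    'M[R]_(2 ^ q, 2 ^ (d - q)) :=
  \matrix_(a, b)
    X [ffun p : 'I_d => if (p < q)%N then bit a p else bit b (p - q)].

Definition ttrank (R : realType) (d : nat) (X : tensor R d) : seq nat :=
  [seq \rank (unfolding X q) | q <- iota 1 d.-1].

Definition basis_tensor (R : realType) (d : nat) (S : {set 'I_d}) :
    tensor R d :=
  [ffun i : multi_index d =>
    (i == [ffun j : 'I_d => if j \in S then 1 else 0])%:R].

Definition subset_span (R : realType) (d : nat) (S : {set 'I_d}) :
    {vspace tensor R d} :=
  <<[seq basis_tensor R J | J in powerset S]>>%VS.

Definition LC (R : realType) (d k s : nat) (X : tensor R d) : Prop :=
  exists (S : 'I_k -> {set 'I_d}) (XS : 'I_k -> tensor R d),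
    [/\ forall t, (#|S t| <= s)%N,
        forall t, XS t \in subset_span R (S t)
      & X = \sum_t XS t].

Definition model (R : realType) (d r s k : nat) (C : R) (X : tensor R d) :
    Prop :=
  [/\ all (fun rho => rho <= r)%N (ttrank X), LC k s X & frobenius X <= C].

Definition minimizer (R : realType) (T : Type) (M : T -> Prop) (f : T -> R)
    (x : T) : Prop :=
  M x /\ forall z, M z -> f x <= f z.

(* Main.v *)
Require Import Defs.
From mathcomp Require Import all_boot all_order all_algebra.
From mathcomp Require Import reals ring.

(** The difference of two points of the model at (r, s, k, C) lies in the model
    at (2r, s, 2k, 2C), so the lower isometry bound, with [1 - eps > 0], makes
    the measurement injective on the model.  The minimal residual is 0, attained
    at [Xstar], and any other minimizer has the same measurements. *)

Set Implicit Arguments.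
Unset Strict Implicit.
Unset Printing Implicit Defensive.

Import Order.TTheory GRing.Theory Num.Theory.

Local Open Scope ring_scope.

Section L2Norm.
Variables (R : realType) (n : nat).
Implicit Types x y : 'cV[R]_n.

Lemma l2norm_ge0 x : 0 <= l2norm x.
Proof. exact: sqrtr_ge0. Qed.

Lemma sqr_l2norm x : l2norm x ^+ 2 = \sum_i x i 0 ^+ 2.
Proof. by rewrite sqr_sqrtr // sumr_ge0 // => i _; rewrite sqr_ge0. Qed.

Lemma l2norm0 : l2norm (0 : 'cV[R]_n) = 0.
Proof. by rewrite /l2norm big1 ?sqrtr0 // => i _; rewrite mxE expr0n. Qed.

Lemma l2norm_eq0 x : l2norm x = 0 -> x = 0.
Proof.
move=> x0; have /eqP := sqr_l2norm x; rewrite x0 expr0n /= eq_sym.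
rewrite psumr_eq0 => [/allP xi0|i _]; last exact: sqr_ge0.
apply/colP => i; rewrite mxE; apply/eqP.
by rewrite -sqrf_eq0; apply: xi0; rewrite mem_index_enum.
Qed.

(** The parallelogram identity [|x - y|^2 + |x + y|^2 = 2 (|x|^2 + |y|^2)], with [|x + y|^2]
    dropped, bounds the squared left side by [4 c^2]. *)
Lemma l2normB_le c x y : l2norm x <= c -> l2norm y <= c -> l2norm (x - y) <= 2 * c.
Proof.
move=> xc yc; have c0 : 0 <= c := le_trans (l2norm_ge0 x) xc.
have c20 : 0 <= 2 * c by rewrite mulr_ge0.
have sqr_le (z : 'cV[R]_n) : l2norm z <= c -> l2norm z ^+ 2 <= c ^+ 2.
  by move=> zc; rewrite !expr2 ler_pM ?l2norm_ge0.
rewrite -(@ler_pXn2r _ 2) ?nnegrE ?l2norm_ge0 //.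
have -> : (2 * c) ^+ 2 = 2 * (c ^+ 2 + c ^+ 2) by ring.
apply: (@le_trans _ _ (2 * (l2norm x ^+ 2 + l2norm y ^+ 2))); last first.
  by rewrite ler_pM2l // lerD // sqr_le.
rewrite !sqr_l2norm -big_split mulr_sumr; apply: ler_sum => i _ /=.
rewrite !mxE -subr_ge0.
suff -> : 2 * (x i 0 ^+ 2 + y i 0 ^+ 2) - (x i 0 - y i 0) ^+ 2 =
          (x i 0 + y i 0) ^+ 2 by rewrite sqr_ge0.
by ring.
Qed.

End L2Norm.

Section Tensors.
Variables (R : realType) (d : nat).
Implicit Types X Y : tensor R d.

Lemma vecB X Y : vec (X - Y) = vec X - vec Y.
Proof. by apply/colP => j; rewrite !mxE !ffunE. Qed.

(** Makes the binary code of a multi-index a legal position in a vectorized tensor, so that [vecE]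
    reaches every entry. *)
Lemma multi_index_sum_lt (i : multi_index d) : (\sum_(q < d) i q * 2 ^ q < 2 ^ d)%N.
Proof.
elim: d i => [|e IHe] i; first by rewrite big_ord0.
rewrite big_ord_recr /= expnS mul2n -addnn -addSn leq_add //.
  (* The digits below the top one are repackaged as a multi-index of length [e], the form that the
     induction hypothesis expects. *)
  under eq_bigr => q _ do rewrite -[i _](ffunE (fun q => i (widen_ord (leqnSn e) q))).
  exact: IHe.
by rewrite -{2}[(2 ^ e)%N]mul1n leq_mul2r -ltnS ltn_ord orbT.
Qed.

Lemma vec_inj : injective (@vec R d).
Proof.
move=> X Y eqXY; apply/ffunP => i.
by rewrite -!(@vecE _ _ _ i (Ordinal (multi_index_sum_lt i))) ?eqXY.
Qed.

Lemma measurementB m (nu : 'I_m -> 'I_(2 ^ d)) X Y :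
  measurement nu (X - Y) = measurement nu X - measurement nu Y.
Proof. by rewrite /measurement vecB mulmxBr. Qed.

(** Unfolding is linear and rank is subadditive; this is the source of the factor 2 in [2 * r]. *)
Lemma rank_unfoldingB X Y q :
  (\rank (unfolding (X - Y)%R q) <= \rank (unfolding X q) + \rank (unfolding Y q))%N.
Proof.
have -> : unfolding (X - Y) q = unfolding X q - unfolding Y q.
  by apply/matrixP => a b; rewrite !mxE !ffunE.
by rewrite (leq_trans (mxrank_add _ _)) // mxrank_opp.
Qed.

(** The two families of supports are concatenated, so the number of terms adds up while [s] is
    unchanged; the sign is absorbed because each span is a subspace. *)
Lemma LCB k1 k2 s X Y : LC k1 s X -> LC k2 s Y -> LC (k1 + k2) s (X - Y).
Proof.
move=> [S [XS [leS XSin ->]]] [T [YT [leT YTin ->]]].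
exists (fun t => match split t with inl i => S i | inr j => T j end).
exists (fun t => match split t with inl i => XS i | inr j => - YT j end).
split=> [t|t|]; [by case: split | by case: split => j; rewrite ?rpredN |].
rewrite big_split_ord -sumrN; congr (_ + _); apply: eq_bigr => i _.
  by rewrite (unsplitK (inl i)).
by rewrite (unsplitK (inr i)).
Qed.

Lemma modelB r s k C X Y :
  model r s k C X -> model r s k C Y ->
  model (2 * r) s (2 * k) (2 * C) (X - Y).
Proof.
move=> [/allP rX LX nX] [/allP rY LY nY]; split.
- apply/allP => _ /mapP[q qin ->].
  rewrite (leq_trans (rank_unfoldingB _ _ _)) // mul2n -addnn leq_add //.
    by apply: rX; apply: map_f.
  by apply: rY; apply: map_f.
- by rewrite mul2n -addnn; apply: LCB.
- by rewrite /frobenius vecB l2normB_le.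
Qed.

End Tensors.

Theorem corollary4p6 (R : realType) (d r k s m : nat) (C : R)
    (nu : 'I_m -> 'I_(2 ^ d)) (Xstar : tensor R d) (y : 'cV[R]_m) (eps : R) :
  (1 <= d)%N -> (1 <= r)%N -> (1 <= k)%N -> (s <= d)%N -> (1 <= m)%N ->
  0 < C ->
  model r s k C Xstar ->
  y = measurement nu Xstar ->
  eps < 1 ->
  (forall D : tensor R d, model (2 * r) s (2 * k) (2 * C) D ->
     (1 - eps) * frobenius D ^+ 2 <= l2norm (measurement nu D) ^+ 2 /\
     l2norm (measurement nu D) ^+ 2 <= (1 + eps) * frobenius D ^+ 2) ->
  unique (minimizer (model r s k C)
            (fun X : tensor R d => l2norm (measurement nu X - y)))
         Xstar.
Proof.
move=> _ _ _ _ _ _ MX -> eps1 RIP; split.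
  by split=> // Z _; rewrite subrr l2norm0 l2norm_ge0.
(* Comparing [Z] with the competitor [Xstar], whose residual is 0, forces the residual of [Z] to be
   at most 0. *)
move=> Z [MZ /(_ _ MX)]; rewrite subrr l2norm0 => resZ_le0.
have [+ _] := RIP _ (modelB MX MZ).
have /l2norm_eq0/eqP : l2norm (measurement nu Z - measurement nu Xstar) = 0.
  by apply/eqP; rewrite eq_le resZ_le0 l2norm_ge0.
rewrite subr_eq0 => /eqP eqA.
(* The middle term of the isometry bound vanishes for [Xstar - Z]; dividing by [1 - eps] leaves a
   squared Frobenius norm that is at most 0. *)
rewrite measurementB eqA subrr l2norm0 expr0n /= pmulr_rle0 ?subr_gt0 // => D2_le0.
apply: vec_inj; apply/eqP; rewrite -subr_eq0 -vecB; apply/eqP/l2norm_eq0/eqP.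
by rewrite -sqrf_eq0 eq_le D2_le0 sqr_ge0.
Qed.
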